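(* Let $k\ge 1$ be an integer. The Lucas number $L_k$ can be written as a product of three repdigits (in base $10$), i.e. $$L_k=d_1\frac{10^\ell-1}{9}\cdot d_2\frac{10^m-1}{9}\cdot d_3\frac{10^n-1}{9}$$ for some integers $1\le d_1,d_2,d_3\le 9$ and $1\le \ell\le m\le n$, if and only if $L_k\in\{1,3,4,7,11,18\}$.
   Context: $(L_n)_{n\ge 0}$ is the Lucas sequence: $L_0=2$, $L_1=1$, $L_{n+2}=L_{n+1}+L_n$. A repdigit is a positive integer all of whose decimal digits are equal, i.e. a number $d\frac{10^m-1}{9}$ with $m\ge 1$, $1\le d\le 9$. *)

(* Defs.v *)
From mathcomp Require Import all_boot.

Fixpoint lucas (n : nat) : nat :=
  match n with
  | 0 => 2
  | 1 => 1
  | S ((S m) as p) => lucas p + lucas m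
  end.

Definition repunit (m : nat) : nat := (10 ^ m - 1) %/ 9.

Definition repdigit (d m : nat) : nat := d * repunit m.

(* Main.v *)
(* Modulo M = 33000 = 1000 * 33 the Lucas sequence has period 600, and every
   repunit of length at least 3 lies in the 6-cycle of r -> 10 r + 1 through
   111, since 10^m = 0 mod 1000 for m >= 3 and 10^6 = 1 mod 297. No product of
   three digits and three repunits of which one has length at least 3 is
   congruent mod M to a Lucas number. If all lengths are at most 2, there
   are finitely many products, and those congruent to a Lucas number mod M
   are 1, 2, 3, 4, 7, 11, 18; of these 2 = L_0 only. *)
Require Import Defs.
From mathcomp Require Import all_boot.
From Stdlib Require Import NArith.

(* Residues live in the binary type N so that the finite checks compute. *)
Definition modulus : N := 33000%num.

Definition mul_mod (a b : N) : N := N.modulo (N.mul a b) modulus.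

Lemma mul_modE a b :
  N.modulo (N.mul a b) modulus =
  mul_mod (N.modulo a modulus) (N.modulo b modulus).
Proof. by rewrite /mul_mod N.Div0.mul_mod. Qed.

(** Keeping two consecutive residues turns the second-order recurrence into the orbit of a single
    map, to which [looping] applies. *)
Definition lucas_step (s : N * N) : N * N :=
  (s.2, N.modulo (N.add s.1 s.2) modulus).

Definition lucas_residues : seq N :=
  undup (unzip1 (traject lucas_step (2%num, 1%num) 600)).

Lemma iter_lucas_step k :
  iter k lucas_step (2%num, 1%num) =
  (N.modulo (N.of_nat (lucas k)) modulus,
   N.modulo (N.of_nat (lucas k.+1)) modulus).
Proof.
elim: k => [|k IHk]; first by [].
rewrite iterS IHk /lucas_step /=; congr pair.
by rewrite -N.Div0.add_mod -Nnat.Nat2N.inj_add plusE addnC.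
Qed.

Lemma lucas_mod k : N.modulo (N.of_nat (lucas k)) modulus \in lucas_residues.
Proof.
have /loopingP/(_ k) : looping lucas_step (2%num, 1%num) 600 by vm_compute.
by rewrite iter_lucas_step mem_undup => /(map_f fst).
Qed.

Lemma repunitS m : repunit m.+1 = 10 * repunit m + 1.
Proof.
(* The truncating division in [repunit] is exact since 10 = 1 mod 9. The recurrence then follows
   after multiplying by 9 and adding 1. *)
have repunit9 n : repunit n * 9 + 1 = 10 ^ n.
  rewrite divnK ?subnK ?expn_gt0 // -eqn_mod_dvd ?expn_gt0 //.
  by rewrite -modnXm exp1n.
apply/eqP; rewrite -(eqn_pmul2r (isT : 0 < 9)) -(eqn_add2r 1) repunit9 expnS.
by rewrite -repunit9 mulnDr mulnDl -addnA mulnA.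
Qed.

Definition repunit_step (r : N) : N :=
  N.modulo (N.add (N.mul 10 r) 1) modulus.

Definition long_repunit_residues : seq N := traject repunit_step 111%num 6.

Lemma long_repunit_mod m :
  N.modulo (N.of_nat (repunit m.+3)) modulus \in long_repunit_residues.
Proof.
have -> : N.modulo (N.of_nat (repunit m.+3)) modulus =
    iter m repunit_step 111%num; last first.
  by have /loopingP/(_ m) : looping repunit_step 111%num 6 by vm_compute.
elim: m => [|m IHm]; first by vm_compute.
rewrite iterS -IHm repunitS /repunit_step.
rewrite -plusE -multE Nnat.Nat2N.inj_add Nnat.Nat2N.inj_mul.
rewrite -N.Div0.add_mod_idemp_l -(N.Div0.add_mod_idemp_l (N.mul _ _)).
by rewrite N.Div0.mul_mod_idemp_r.
Qed.

Definition products (A B : seq N) : seq N :=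
  undup [seq N.mul a b | a <- A, b <- B].

Definition products_mod (A B : seq N) : seq N :=
  undup [seq mul_mod a b | a <- A, b <- B].

Lemma products_in A B a b :
  a \in A -> b \in B -> N.mul a b \in products A B.
Proof. by move=> aA bB; rewrite mem_undup allpairs_f. Qed.

Lemma products_mod_in A B a b :
  a \in A -> b \in B -> mul_mod a b \in products_mod A B.
Proof. by move=> aA bB; rewrite mem_undup allpairs_f. Qed.

Definition digits : seq N := [seq N.of_nat d | d <- iota 1 9].
Definition digit_products : seq N := products (products digits digits) digits.

Definition repunit_residues : seq N :=
  [:: 1%num, 11%num & long_repunit_residues].
(** Only the last factor, the one of greatest length, is known to be long; the other two may have
    any positive length. *)
Definition repunit_product_residues : seq N :=
  products_mod (products_mod repunit_residues repunit_residues)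
    long_repunit_residues.

Definition short_repunits : seq N := [:: 1%num; 11%num].
Definition short_repunit_products : seq N :=
  products (products short_repunits short_repunits) short_repunits.

Lemma lucas_not_long_product :
  all (fun c => all (fun r => mul_mod c r \notin lucas_residues)
                    repunit_product_residues) digit_products.
Proof. by vm_compute. Qed.

(** These products can exceed the modulus, so the residue serves only as a filter and the conclusion
    identifies the exact value. *)
Lemma lucas_short_product :
  all (fun c => all (fun r =>
      (N.modulo (N.mul c r) modulus \in lucas_residues) ==>
      (N.mul c r \in [:: 1; 2; 3; 4; 7; 11; 18]%num))
    short_repunit_products) digit_products.
Proof. by vm_compute. Qed.

Lemma digit_in d : 1 <= d <= 9 -> N.of_nat d \in digits.
Proof. by move=> d_digit; rewrite map_f // mem_iota. Qed.

Lemma repunit_mod m :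
  0 < m -> N.modulo (N.of_nat (repunit m)) modulus \in repunit_residues.
Proof. by case: m => [|[|[|m]]] // _; rewrite 2!in_cons long_repunit_mod !orbT. Qed.

Lemma short_repunit m :
  0 < m <= 2 -> N.of_nat (repunit m) \in short_repunits.
Proof. by case: m => [|[|[|]]]. Qed.

(** From index 3 on, unfolding twice gives a sum of three positive Lucas numbers, hence at least
    3. *)
Lemma lucas_neq2 k : 0 < k -> lucas k != 2.
Proof.
have lucas_gt0 j : 0 < lucas j /\ 0 < lucas j.+1.
  by elim: j => // j [L0 L1]; split=> //=; rewrite addn_gt0 L0 orbT.
case: k => [|[|[|k]]] // _; rewrite -[lucas _]/(lucas k.+2 + lucas k.+1).
have [L0 L1] := lucas_gt0 k.
rewrite -[lucas k.+2]/(lucas k.+1 + lucas k) neq_ltn.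
by rewrite -addnAC (leq_add (leq_add L1 L1) L0) orbT.
Qed.

Theorem theorem4p3 (k : nat) : 1 <= k ->
  (exists d1 d2 d3 l m n : nat,
      (1 <= d1 <= 9) /\ (1 <= d2 <= 9) /\ (1 <= d3 <= 9) /\
      1 <= l /\ l <= m /\ m <= n /\
      lucas k = repdigit d1 l * repdigit d2 m * repdigit d3 n)
  <-> lucas k \in [:: 1; 3; 4; 7; 11; 18].
Proof.
move=> k_gt0; split; last first.
  rewrite !inE => Lk.
  (* Two digits and one repunit suffice: 11 is the repunit of length 2, and 18 = 2 * 9. The third
     digit and the other two lengths are then 1. *)
  have [d1 [d2 [n [d1P d2P n_gt0 ->]]]] : exists d1 d2 n : nat,
      [/\ 1 <= d1 <= 9, 1 <= d2 <= 9, 0 < n &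
          lucas k = d1 * d2 * repunit n].
    case/orP: Lk => [/eqP->|]; first by exists 1, 1, 1.
    case/orP=> [/eqP->|]; first by exists 1, 3, 1.
    case/orP=> [/eqP->|]; first by exists 1, 4, 1.
    case/orP=> [/eqP->|]; first by exists 1, 7, 1.
    case/orP=> [/eqP->|/eqP->]; first by exists 1, 1, 2.
    by exists 2, 9, 1.
  exists d1, d2, 1, 1, 1, n; do 6!split=> //.
  by rewrite /repdigit (_ : repunit 1 = 1) // !muln1 mul1n.
case=> d1 [d2 [d3 [l [m [n [d1P [d2P [d3P [l_gt0 [le_lm [le_mn Lk]]]]]]]]]]].
set c := N.mul (N.mul (N.of_nat d1) (N.of_nat d2)) (N.of_nat d3).
pose R j := N.of_nat (repunit j).
pose r := N.mul (N.mul (R l) (R m)) (R n).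
have c_in : c \in digit_products by rewrite !products_in ?digit_in.
have LkN : N.of_nat (lucas k) = N.mul c r.
  rewrite /c /r /R -!Nnat.Nat2N.inj_mul !multE Lk /repdigit; congr N.of_nat.
  by rewrite (mulnACA d1) (mulnACA (d1 * d2)).
have Lk_in := lucas_mod k; rewrite LkN in Lk_in.
have m_gt0 := leq_trans l_gt0 le_lm; have n_gt0 := leq_trans m_gt0 le_mn.
(* As [n] is the greatest length, [n <= 2] makes all three repunits short. *)
have [n_le2|n_gt2] := leqP n 2.
  have m_le2 := leq_trans le_mn n_le2; have l_le2 := leq_trans le_lm m_le2.
  have r_in : r \in short_repunit_products.
    by rewrite !products_in ?short_repunit ?l_gt0 ?m_gt0 ?n_gt0.
  have /allP/(_ c c_in)/allP/(_ r r_in) := lucas_short_product.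
  rewrite Lk_in -LkN /= => Lk_small.
  have : lucas k \in [:: 1; 2; 3; 4; 7; 11; 18].
    by rewrite -[lucas k]Nnat.Nat2N.id; apply: (map_f N.to_nat Lk_small).
  by rewrite !inE (negPf (lucas_neq2 _ k_gt0)).
have r_in : N.modulo r modulus \in repunit_product_residues.
  rewrite mul_modE (mul_modE (R l)).
  apply: products_mod_in.
    by apply: products_mod_in; apply: repunit_mod.
  by rewrite /R -(subnK n_gt2) addn3; apply: long_repunit_mod.
(* The check uses unreduced digit products, whereas [mul_modE] reduces both factors; the two agree
   because [c] is at most 9^3 = 729. *)
have c_small : N.modulo c modulus = c.
  by apply/eqP; move: c c_in {Lk_in LkN}; apply/allP; vm_compute.
have /allP/(_ c c_in)/allP/(_ _ r_in) := lucas_not_long_product.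
by rewrite -[c in mul_mod c]c_small -mul_modE Lk_in.
Qed.
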